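(* Every Auslander--Gorenstein ring is a BF-ring.
   Context: Rings are associative with identity; noetherian means left and right noetherian. Let $R$ be a noetherian ring. The (homological) grade of a left or right $R$-module $M$ is $j(M)=\inf\{i:\operatorname{Ext}^i_R(M,R)\neq0\}\in\mathbb{Z}_{\ge0}\cup\{\omega\}$, with $j(M)=\omega$ if no such $i$ exists (in particular $j(0)=\omega$). $R$ satisfies the Auslander condition if for every finitely generated left or right $R$-module $M$ and every integer $i\ge0$, $j(N)\ge i$ for every submodule $N$ of $\operatorname{Ext}^i_R(M,R)$. $R$ is Auslander--Gorenstein if it is noetherian, has finite (and equal) left and right injective dimensions as a module over itself, and satisfies the Auslander condition. $R^\bullet$ is the multiplicative monoid of cancellative elements (neither left nor right zero-divisors) of $R$. A nonunit $u\in R^\bullet$ is an atom if $u=ab$ with $a,b\in R^\bullet$ implies that $a$ or $b$ is a unit. $R$ is a BF-ring if every nonunit of $R^\bullet$ is a finite product of atoms of $R^\bullet$ and for every $a\in R^\bullet$ there is $\lambda(a)\in\mathbb{Z}_{\ge 0}$ such that $k\le\lambda(a)$ whenever $a=u_1\cdots u_k$ with atoms $u_i$ of $R^\bullet$. *)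

(* Defs.v *)
From HB Require Import structures.
From mathcomp Require Import all_boot all_order all_algebra.
From mathcomp Require Import boolp classical_sets functions cardinality fsbigop.

Set Implicit Arguments.
Unset Strict Implicit.
Unset Printing Implicit Defensive.

Import GRing.Theory.

Local Open Scope ring_scope.
Local Open Scope quotient_scope.

(* Rings are [pzRingType]s, so that the zero ring is allowed. Left R-modules
   are [lmodType R] and right R-modules are left modules over the converse
   ring, i.e. [lmodType R^c]. *)

Section Kernel.
Variables (R : pzRingType) (U V : lmodType R) (f : {linear U -> V}).

Definition kerp : {pred U} := fun x => f x == 0.

Lemma kerp_submod : submod_closed kerp.
Proof.
split=> [|a u v /eqP fu /eqP fv]; first by apply/eqP; rewrite linear0.
by apply/eqP; rewrite linearP fu fv scaler0 addr0.
Qed.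

HB.instance Definition _ :=
  GRing.isSubmodClosed.Build R U kerp (GRing.submod_closed_semi kerp_submod).

Definition ker := {x : U | x \in kerp}.
HB.instance Definition _ := SubChoice.on ker.
HB.instance Definition _ := [SubChoice_isSubLmodule of ker by <:].

End Kernel.

Section QuotientModule.
Variables (R : pzRingType) (V : lmodType R) (S : submodClosed V).

(* A [submodClosed] predicate is not seen by the library as a [zmodClosed] one. *)
Definition submodp : {pred V} := S.

Fact submodp_closed : submod_closed submodp.
Proof. exact: GRing.subsemimod_closed_submod (GRing.subsemimodClosedP S). Qed.

HB.instance Definition _ :=
  GRing.isSubmodClosed.Build R V submodp (GRing.submod_closed_semi submodp_closed).

Local Notation Q := (Quotient.quot submodp).

Definition quot_lmod : Type := Q.
HB.instance Definition _ := GRing.Zmodule.on quot_lmod.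

Definition quot_scale (a : R) (x : quot_lmod) : quot_lmod :=
  \pi_Q (a *: repr (x : Q)).

Lemma quot_scaleE a (v : V) :
  quot_scale a (\pi_Q v) = \pi_Q (a *: v).
Proof.
apply/eqP; rewrite /quot_scale -Quotient.idealrBE -scalerBr.
by apply: rpredZ; rewrite Quotient.idealrBE reprK.
Qed.

Let quotP (x : quot_lmod) : exists v : V, x = \pi_Q v.
Proof. by exists (repr (x : Q)); rewrite reprK. Qed.

Let quotD (u v : V) : (\pi_Q u : quot_lmod) + \pi_Q v
  = \pi_Q (u + v).
Proof. by rewrite [RHS]raddfD. Qed.

Fact quot_scaleA a b x : quot_scale a (quot_scale b x) = quot_scale (a * b) x.
Proof. by have [v ->] := quotP x; rewrite !quot_scaleE scalerA. Qed.
Fact quot_scale1 : left_id 1 quot_scale.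
Proof. by move=> x; have [v ->] := quotP x; rewrite quot_scaleE scale1r. Qed.
Fact quot_scaleDr : right_distributive quot_scale +%R.
Proof.
move=> a x y; have [u ->] := quotP x; have [v ->] := quotP y.
by rewrite !(quotD, quot_scaleE) scalerDr.
Qed.
Fact quot_scaleDl x : {morph quot_scale^~ x : a b / a + b}.
Proof.
by move=> a b; have [v ->] := quotP x; rewrite !(quotD, quot_scaleE) scalerDl.
Qed.
HB.instance Definition _ := GRing.Zmodule_isLmodule.Build R quot_lmod
  quot_scaleA quot_scale1 quot_scaleDr quot_scaleDl.

End QuotientModule.

(* [cohomology f g] is ker g / im f when g \o f = 0 (in general, it is
   ker g / (ker g `&` im f)). *)
Section Cohomology.
Variables (R : pzRingType) (A B C : lmodType R).
Variables (f : {linear A -> B}) (g : {linear B -> C}).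

Definition boundary : {pred ker g} := fun z => `[< exists x, f x = val z >].

Lemma boundary_submod : submod_closed boundary.
Proof.
split=> [|a u v /asboolP[x fx] /asboolP[y fy]]; apply/asboolP.
  by exists 0; rewrite !linear0.
by exists (a *: x + y); rewrite !linearP fx fy.
Qed.

HB.instance Definition _ := GRing.isSubmodClosed.Build R (ker g) boundary
  (GRing.submod_closed_semi boundary_submod).

Definition cohomology : lmodType R := quot_lmod boundary.

End Cohomology.

(* The right R-module Hom_R(M, R): it is a submodule of the right module of all
   functions from M to R, since a *: f = fun m => f m * a for a : R^c and
   f : M -> R^c^o. *)
Section Dual.
Variables (R : pzRingType) (M : lmodType R).

Definition dualp : {pred M -> R^c^o} := fun f => `[< linear (f : M -> R^o) >].

Lemma dualp_submod : submod_closed dualp.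
Proof.
split=> [|a f g /asboolP lf /asboolP lg]; apply/asboolP => b u v.
  by rewrite /= [RHS]addr0 [RHS]mulr0.
have -> w : (a *: f + g) w = (f w : R) * a + g w by [].
rewrite lf lg; change ((b * f u + f v) * a + (b * g u + g v)
  = b * ((f u : R) * a + g u) + ((f v : R) * a + g v) :> R).
by rewrite mulrDl mulrDr -mulrA addrACA.
Qed.

HB.instance Definition _ := GRing.isSubmodClosed.Build R^c (M -> R^c^o) dualp
  (GRing.submod_closed_semi dualp_submod).

Definition dual := {f : M -> R^c^o | f \in dualp}.
HB.instance Definition _ := SubChoice.on dual.
HB.instance Definition _ := [SubChoice_isSubLmodule of dual by <:].

End Dual.

Section DualMap.
Variables (R : pzRingType) (M N : lmodType R) (h : {linear M -> N}).

Fact dual_map_subproof (f : dual N) : (val f \o h : M -> R^c^o) \in @dualp R M.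
Proof.
have /asboolP lf := valP f.
by apply/asboolP => a u v /=; rewrite linearP lf.
Qed.

Definition dual_map (f : dual N) : dual M :=
  exist _ (val f \o h : M -> R^c^o) (dual_map_subproof f).

Fact dual_map_linear : linear dual_map.
Proof. by move=> a f g; apply/val_inj. Qed.

HB.instance Definition _ :=
  GRing.isLinear.Build R^c (dual N) (dual M) *:%R dual_map dual_map_linear.

End DualMap.

(* The free module on the underlying set of M: the finitely supported
   functions M -> R. *)
Section FreeModule.
Variables (R : pzRingType) (M : lmodType R).

Definition freep : {pred M -> R^o} :=
  fun f => `[< finite_set [set m | f m != 0] >].

Lemma freep_submod : submod_closed freep.
Proof.
split=> [|a f g /asboolP finf /asboolP fing]; apply/asboolP.
  rewrite (_ : mkset _ = set0) //; apply/seteqP; split=> // m /=.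
  by rewrite eqxx.
have fin2 : finite_set ([set m | f m != 0] `|` [set m | g m != 0])%classic.
  by rewrite finite_setU.
apply: sub_finite_set fin2 => m /=.
have -> : (a *: f + g) m = a *: f m + g m by [].
have [->|f0 _] := eqVneq (f m) 0; last by left.
by rewrite scaler0 add0r; right.
Qed.

HB.instance Definition _ := GRing.isSubmodClosed.Build R (M -> R^o) freep
  (GRing.submod_closed_semi freep_submod).

Definition free_mod := {f : M -> R^o | f \in freep}.
HB.instance Definition _ := SubChoice.on free_mod.
HB.instance Definition _ := [SubChoice_isSubLmodule of free_mod by <:].

(* The augmentation, which maps the basis element attached to m to m. *)
Definition augment (f : free_mod) : M :=
  \sum_(m \in [set: M]) (val f m : R) *: m.

Lemma augmentE (f : free_mod) (A : set M) : finite_set A ->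
  ([set m | val f m != 0] `<=` A)%classic ->
  augment f = \sum_(m \in A) (val f m : R) *: m.
Proof.
move=> finA sub; apply/esym/fsbig_widen => // m [_ /= nA].
by have [->|/sub//] := eqVneq (val f m) 0; rewrite scale0r.
Qed.

Fact augment_linear : linear augment.
Proof.
move=> a f g; have /asboolP finf := valP f; have /asboolP fing := valP g.
pose A := ([set m | val f m != 0] `|` [set m | val g m != 0])%classic.
have valE m : val (a *: f + g) m = a * (val f m : R) + val g m by [].
have finA : finite_set A by rewrite finite_setU.
rewrite !(@augmentE _ A) //; [|exact: subsetUr|exact: subsetUl|].
- rewrite !fsbig_finite // scaler_sumr -big_split; apply: eq_bigr => m _.
  by rewrite valE scalerDl scalerA.
- move=> m; rewrite /mkset valE.
  have [->|f0 _] := eqVneq (val f m) 0; last by left.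
  by rewrite mulr0 add0r; right.
Qed.

HB.instance Definition _ :=
  GRing.isLinear.Build R free_mod M *:%R augment augment_linear.

End FreeModule.

(* The standard free resolution ... -> P_1 -> P_0 -> M -> 0, where P_n is the
   free module on the n-th syzygy module and d_n : P_(n+1) -> P_n. *)
Section Resolution.
Variables (R : pzRingType) (M : lmodType R).

Fixpoint syzygy (n : nat) : lmodType R :=
  if n is k.+1 then ker (@augment R (syzygy k)) else M.

Definition res (n : nat) : lmodType R := free_mod (syzygy n).

Definition res_d (n : nat) : {linear res n.+1 -> res n} :=
  (val : ker (@augment R (syzygy n)) -> res n)
    \o (@augment R (syzygy n.+1)).

End Resolution.

Lemma augment_surj (R : pzRingType) (M : lmodType R) (m : M) :
  exists f, augment f = m.
Proof.
pose d : M -> R^o := fun x => if x == m then 1 else 0.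
have dP : d \in @freep R M.
  apply/asboolP; apply: sub_finite_set (finite_set1 m) => x /=.
  by rewrite /d; case: (x =P m) => // _; rewrite eqxx.
exists (exist _ d dP).
rewrite (@augmentE _ _ _ [set m]) //; first by
  rewrite fsbig_set1 /= /d eqxx scale1r.
by move=> x; rewrite /mkset /= /d; case: (x =P m) => // _; rewrite eqxx.
Qed.

Lemma res_exact0 (R : pzRingType) (M : lmodType R) (x : res M 0) :
  augment x = 0 <-> exists y, x = res_d M 0 y.
Proof.
split=> [x0|[y ->]]; last by apply/eqP; exact: (valP (augment y)).
have xP : x \in kerp (@augment R M) by apply/eqP.
have [y yx] := augment_surj (exist _ x xP : ker (@augment R M)).
by exists y; rewrite /res_d /= yx.
Qed.

Lemma res_exact (R : pzRingType) (M : lmodType R) n (x : res M n.+1) :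
  res_d M n x = 0 <-> exists y, x = res_d M n.+1 y.
Proof.
rewrite -(@res_exact0 _ (syzygy M n.+1)) /res_d /=.
by split=> [x0|->]; [apply/val_inj; exact: x0 | exact: erefl].
Qed.

(* Ext^i_R(M, R), as a right R-module. In degree 0 the incoming map is \0. *)
Definition Ext (R : pzRingType) (M : lmodType R) (i : nat) : lmodType R^c :=
  if i is k.+1 then cohomology (dual_map (res_d M k)) (dual_map (res_d M k.+1))
  else cohomology (\0 : dual (res M 0) -> dual (res M 0))
                  (dual_map (res_d M 0)).

Definition Ext_neq0 (R : pzRingType) (M : lmodType R) : pred nat :=
  fun i => `[< exists x : Ext M i, x != 0 >].

(* The grade; [None] stands for omega. *)
Definition grade (R : pzRingType) (M : lmodType R) : option nat :=
  if pselect (exists i, Ext_neq0 M i) is left exM then Some (ex_minn exM)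
  else None.

Definition le_grade (i : nat) (j : option nat) : Prop :=
  if j is Some k then (i <= k)%N else True.

Definition fin_gen (R : pzRingType) (M : lmodType R) : Prop :=
  exists n (e : 'I_n -> M), forall m, exists c : 'I_n -> R,
    m = \sum_(k < n) c k *: e k.

Definition left_auslander (R : pzRingType) : Prop :=
  forall M : lmodType R, fin_gen M ->
  forall (i : nat) (S : {pred Ext M i}) (N : subLmodType S),
    le_grade i (grade N).

(* The second half concerns right R-modules M; the left R-modules Ext^i_R(M, R)
   then appear as modules over R^c^c, which has the same operations as R. *)
Definition auslander_condition (R : pzRingType) : Prop :=
  left_auslander R /\ left_auslander R^c.

Definition noetherian_module (R : pzRingType) (M : lmodType R) : Prop :=
  forall I : nat -> {pred M},
    (forall n, submod_closed (I n)) -> (forall n, {subset I n <= I n.+1}) ->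
  exists n, forall m, (n <= m)%N -> I m =i I n.

Definition noetherian_ring (R : pzRingType) : Prop :=
  noetherian_module R^o /\ noetherian_module R^c^o.

Definition injective_module (R : pzRingType) (E : lmodType R) : Prop :=
  forall (A B : lmodType R) (i : {linear A -> B}) (f : {linear A -> E}),
    injective i -> exists g : {linear B -> E}, forall x, g (i x) = f x.

(* M has an injective resolution 0 -> M -> I_0 -> ... -> I_n -> 0. *)
Definition inj_dim_le (R : pzRingType) (M : lmodType R) (n : nat) : Prop :=
  exists (I : nat -> lmodType R) (e : {linear M -> I 0})
         (d : forall k, {linear I k -> I k.+1}),
  [/\ forall k, injective_module (I k),
      injective e,
      forall x, d 0 x = 0 <-> exists m, x = e m,
      forall k x, d k.+1 x = 0 <-> exists y, x = d k y
    & forall k, (n < k)%N -> forall x : I k, x = 0].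

Definition has_inj_dim (R : pzRingType) (M : lmodType R) (n : nat) : Prop :=
  inj_dim_le M n /\ forall m, inj_dim_le M m -> (n <= m)%N.

Definition auslander_gorenstein (R : pzRingType) : Prop :=
  [/\ noetherian_ring R,
      exists n, has_inj_dim R^o n /\ has_inj_dim R^c^o n
    & auslander_condition R].

Section Factorizations.
Variable R : pzRingType.

Definition cancellative (a : R) : Prop := GRing.lreg a /\ GRing.rreg a.

Definition is_unit (a : R) : Prop := exists b, a * b = 1 /\ b * a = 1.

Definition atom (u : R) : Prop :=
  [/\ cancellative u, ~ is_unit u
    & forall a b, cancellative a -> cancellative b -> u = a * b ->
      is_unit a \/ is_unit b].

Definition BF_ring : Prop :=
  (forall a, cancellative a -> ~ is_unit a ->
     exists2 s : seq R, (forall u, u \in s -> atom u) & a = \prod_(u <- s) u)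
  /\
  (forall a, cancellative a ->
     exists l : nat, forall s : seq R, (forall u, u \in s -> atom u) ->
       a = \prod_(u <- s) u -> (size s <= l)%N).

End Factorizations.

(* Main.v *)
From HB Require Import structures.
Require Import Defs.
From mathcomp Require Import all_boot all_algebra.
From mathcomp Require Import boolp classical_sets functions cardinality fsbigop.
From mathcomp Require Import finmap.

(** Fix a cancellative element a. A factorization a = u_1 ... u_k into nonunits
    gives a strictly descending chain of right ideals
    R > u_1 R > u_1 u_2 R > ... > aR, so it suffices to bound the length of
    such chains: then factorizations of maximal length into nonunits exist, their
    factors are atoms, and all factorizations into atoms have bounded length.

    Among the right ideals A that contain a, call closed those equal to their
    [hull], the set of all x such that every linear map A -> R extends to A + xR.
    The ideals bR with a = bc are closed ([closed_principal]). Closed ideals satisfy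
    the ascending chain condition since R is right noetherian, and the descending
    one since R is left noetherian: A is recovered from its dual Hom(A, R), which is
    embedded as a left ideal of R by evaluation at a ([values_inj]). A modular
    lattice with both chain conditions has finite length, which is the bound
    ([closed_ranked]).

    The Auslander condition on left modules enters twice. In degree 1, R/aR is
    Ext^1(R/Ra, R), so the submodules of R/aR have no nonzero map to R
    ([annihilator_mod]); this makes extensions of linear maps unique. In
    degree 2, the quotient of the hull of A by A is embedded in Ext^2(X, R) for a
    finitely generated X, so its submodules N satisfy Hom(N, R) = Ext^1(N, R) = 0
    ([hull_torsion]). Since A `&` C + xR is an extension of A `&` C by
    (A + xR)/A when x lies in C, the hull commutes with intersections with closed
    ideals ([hull_meet]), which is what modularity requires.

    Both applications need a class in Ext^1 or Ext^2, as computed by the standard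
    resolution, with a prescribed annihilator. They come from comparing that
    resolution with an explicit projective presentation: the class of a map k on
    the syzygy K of a projective F is killed by y exactly when k y extends to F
    ([Ext_class_comparison]). *)

Set Implicit Arguments.
Unset Strict Implicit.
Unset Printing Implicit Defensive.

Import GRing.Theory.
Local Open Scope ring_scope.
Local Open Scope quotient_scope.

(** * Grades and projective modules *)

Lemma le_grade_Ext (R : pzRingType) (M : lmodType R) i :
  le_grade i (grade M) -> forall k, (k < i)%N -> forall x : Ext M k, x = 0.
Proof.
rewrite /grade; case: pselect => [exM|nM] /= le k ki x.
  case: ex_minnP le => m _ min le.
  apply/eqP/negPn/negP => x0.
  have /min : Ext_neq0 M k by apply/asboolP; exists x.
  by rewrite leqNgt (leq_trans ki le).
apply/eqP/negPn/negP => x0; apply: nM; exists k.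
by apply/asboolP; exists x.
Qed.

Definition to_linear (R : pzRingType) (U V : lmodType R) (f : U -> V)
    (lf : linear f) : {linear U -> V} :=
  HB.pack f (GRing.isLinear.Build R U V *:%R f lf).

Definition projective (R : pzRingType) (F : lmodType R) : Prop :=
  forall (A B : lmodType R) (p : {linear A -> B}) (f : {linear F -> B}),
    (forall x, exists y, p y = f x) ->
  exists g : {linear F -> A}, forall x, p (g x) = f x.

Lemma regular_projective (R : pzRingType) : projective (R^o : lmodType R).
Proof.
move=> A B p f lift; have [y py] := lift 1.
have gl : linear (fun r : R^o => (r : R) *: y).
  by move=> c r r'; rewrite scalerDl scalerA.
exists (to_linear gl) => r /=.
by rewrite linearZ py -linearZ; congr (f _); exact: mulr1.
Qed.

Lemma row_projective (R : pzRingType) n : projective ('rV[R]_n : lmodType R).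
Proof.
move=> A B p f lift.
have [y py] := choice (fun i : 'I_n => lift (\row_j (i == j)%:R)).
have gl : linear (fun v : 'rV[R]_n => \sum_i v 0 i *: y i).
  move=> c v w; rewrite scaler_sumr -big_split; apply: eq_bigr => i _.
  by rewrite !mxE scalerDl scalerA.
exists (to_linear gl) => v /=.
rewrite linear_sum; under eq_bigr do rewrite linearZ py -linearZ.
rewrite -linear_sum; congr (f _); apply/rowP => k.
rewrite summxE (bigD1 k) //= big1 ?addr0.
  by rewrite !mxE eqxx mulr1.
by move=> i ik; rewrite !mxE (negPf ik) mulr0.
Qed.

Lemma finite_support (R : pzRingType) (M : lmodType R) (z : free_mod M) :
  finite_set [set m | val z m != 0]%classic.
Proof. exact/asboolP/(valP z). Qed.

(** This makes the terms of the standard free resolution comparable with any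
    other projective resolution. *)
Lemma free_projective (R : pzRingType) (M : lmodType R) :
  projective (free_mod M : lmodType R).
Proof.
move=> A B p f lift.
pose d m : M -> R^o := fun x => if x == m then 1 else 0.
have dP m : d m \in @freep R M.
  apply/asboolP; apply: sub_finite_set (finite_set1 m) => x /=.
  by rewrite /d; case: (x =P m) => // _; rewrite eqxx.
pose e m : free_mod M := exist _ (d m) (dP m).
have [c pc] := choice (fun m => lift (e m)).
pose g (z : free_mod M) : A := \sum_(m \in [set: M]) (val z m : R) *: c m.
have gE (z : free_mod M) (X : set M) : finite_set X ->
    ([set m | val z m != 0] `<=` X)%classic ->
    g z = \sum_(m \in X) (val z m : R) *: c m.
  move=> finX sub; apply/esym/fsbig_widen => // m [_ /= nX].
  by have [->|/sub//] := eqVneq (val z m) 0; rewrite scale0r.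
have gl : linear g.
  move=> a z w.
  pose X := ([set m | val z m != 0] `|` [set m | val w m != 0])%classic.
  have finX : finite_set X by rewrite finite_setU; split; apply: finite_support.
  have valE m : val (a *: z + w) m = a * (val z m : R) + val w m by [].
  rewrite !(@gE _ X) //; [|exact: subsetUr|exact: subsetUl|].
  - rewrite !fsbig_finite // scaler_sumr -big_split; apply: eq_bigr => m _.
    by rewrite valE scalerDl scalerA.
  - move=> m; rewrite /mkset valE.
    have [->|z0 _] := eqVneq (val z m) 0; last by left.
    by rewrite mulr0 add0r; right.
exists (to_linear gl) => z /=.
have finz := finite_support z.
rewrite (gE z _ finz) // fsbig_finite // linear_sum.
under eq_bigr do rewrite linearZ pc -linearZ.
rewrite -linear_sum; congr (f _); apply/val_inj/funext => x.
have -> (X : {fset M}) : val (\sum_(i <- X) (val z i : R) *: e i) x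
    = \sum_(i <- X) (val z i : R) * (if x == i then 1 else 0).
  by elim/big_rec2: _ => // i u w _ <-.
have [x0|x0] := eqVneq (val z x) 0.
  rewrite x0 big1_seq // => i /= _.
  by case: eqP => [<-|]; rewrite ?x0 ?mulr0 ?mul0r.
rewrite (big_fsetD1 x) /=; last by rewrite in_fset_set // mem_setE.
rewrite eqxx mulr1 big1_seq ?addr0 // => i /=.
by rewrite in_fsetD1 eq_sym => /andP[/negPf -> _]; rewrite mulr0.
Qed.

(** * Classes in Ext *)

Lemma quot_pi_linear (R : pzRingType) (V : lmodType R) (S : submodClosed V) :
  linear (fun v : V => \pi_(Quotient.quot (submodp S)) v : quot_lmod S).
Proof.
move=> c u v; rewrite [LHS]raddfD; congr (_ + _).
exact: esym (quot_scaleE S c u).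
Qed.

Definition quot_pi (R : pzRingType) (V : lmodType R) (S : submodClosed V) :
  {linear V -> quot_lmod S} := to_linear (@quot_pi_linear R V S).

Lemma quot_pi_eq0 (R : pzRingType) (V : lmodType R) (S : submodClosed V) v :
  quot_pi S v = 0 <-> v \in S.
Proof.
have -> : (v \in S) = (v - 0 \in submodp S) by rewrite subr0.
rewrite Quotient.idealrBE.
have <- : \pi_(Quotient.quot (submodp S)) 0 = 0 :> quot_lmod S.
  by rewrite [LHS]raddf0.
by split=> [/eqP|/eqP].
Qed.

Lemma quot_pi_surj (R : pzRingType) (V : lmodType R) (S : submodClosed V) x :
  exists v, quot_pi S v = x.
Proof. by exists (repr (x : Quotient.quot (submodp S))); exact: reprK. Qed.

Lemma linear_dualp (R : pzRingType) (M : lmodType R) (f : {linear M -> R^o}) :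
  (f : M -> R^c^o) \in @dualp R M.
Proof. by apply/asboolP; exact: linearP. Qed.

Definition to_dual (R : pzRingType) (M : lmodType R) (f : {linear M -> R^o}) :
  dual M := exist (fun g : M -> R^c^o => g \in @dualp R M) f (linear_dualp f).

Lemma Ext0_eq0 (R : pzRingType) (M : lmodType R) (f : {linear M -> R^o}) :
  (forall x : Ext M 0, x = 0) -> forall m, f m = 0.
Proof.
move=> E0 m.
pose g := to_dual (f \o @augment R M : {linear res M 0 -> R^o}).
have gK : g \in kerp (dual_map (res_d M 0)).
  apply/eqP/val_inj/funext => x /=.
  by rewrite (_ : augment (val _) = 0) ?linear0 //; apply/res_exact0; exists x.
pose z : ker (dual_map (res_d M 0)) := exist _ g gK.
pose d0 : {linear dual (res M 0) -> dual (res M 0)} := \0.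
have := E0 (quot_pi (@boundary _ _ _ _ d0 (dual_map (res_d M 0))) z).
move/quot_pi_eq0 => /asboolP[x /(congr1 val) /= e].
have [w <-] := augment_surj m.
by rewrite -[f _]/((f \o @augment R M) w) -e.
Qed.

(** A linear map on the (n+1)-st syzygy is a cocycle of degree n+1, and a multiple
    of its class vanishes exactly when that multiple extends to the whole of the
    n-th free module: this is Ext^(n+1) as a cokernel of restriction. *)
Lemma Ext_class (R : pzRingType) (M : lmodType R) n
    (k : {linear syzygy M n.+1 -> R^o}) :
  exists w : Ext M n.+1, forall y : R, (y : R^c) *: w = 0 <->
    exists mu : {linear res M n -> R^o},
      forall z : syzygy M n.+1, mu (val z) = k z * y.
Proof.
pose g := to_dual (k \o @augment R (syzygy M n.+1) : {linear res M n.+1 -> R^o}).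
have gK : g \in kerp (dual_map (res_d M n.+1)).
  apply/eqP/val_inj/funext => x /=.
  by rewrite (_ : augment (val _) = 0) ?linear0 //; apply/res_exact0; exists x.
pose z : ker (dual_map (res_d M n.+1)) := exist _ g gK.
exists (quot_pi (@boundary _ _ _ _ (dual_map (res_d M n)) (dual_map (res_d M n.+1))) z) => y.
rewrite -linearZ quot_pi_eq0; split=> [/asboolP[x /(congr1 val) /= e]|[mu muE]].
  have /asboolP lx := valP x.
  exists (to_linear (lx : linear (val x : _ -> R^o))) => v /=.
  have [w <-] := augment_surj v.
  by move: (congr1 (fun h => h w) e).
apply/asboolP; exists (to_dual mu); apply/val_inj/funext => v /=.
exact: muE.
Qed.

(** * Ext from an arbitrary projective presentation *)

(** Partial maps are encoded by total functions that are constrained on K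
    only, which avoids a module structure on each submodule K. *)
Definition linear_on (R : pzRingType) (F : lmodType R) (K : F -> Prop)
    (k : F -> R) : Prop :=
  forall c w w', K w -> K w' -> k (c *: w + w') = c * k w + k w'.

Definition extends (R : pzRingType) (F : lmodType R) (K : F -> Prop)
    (k : F -> R) : Prop :=
  exists l : {linear F -> R^o}, forall w, K w -> l w = k w.

(** The maps u and v compare the standard resolution with a module F that has K
    in the role of the syzygy, and u \o v is the identity up to h, which is zero
    on K, and up to values in K. Extendability of a map from K to F is then the
    same question as extendability from the standard syzygy. *)
Lemma Ext_class_comparison (R : pzRingType) (M F : lmodType R) n (K : F -> Prop)
    (u : {linear res M n -> F}) (v : {linear F -> res M n})
    (h : {linear F -> F}) :
  (forall z, augment z = 0 -> K (u z)) ->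
  (forall w, K w -> augment (v w) = 0) ->
  (forall w, K w -> h w = 0) ->
  (forall w, K (u (v w) - w - h w)) ->
  forall k : F -> R, linear_on K k ->
  exists w : Ext M n.+1, forall y : R, (y : R^c) *: w = 0 <->
    extends K (fun w => k w * y).
Proof.
move=> uK Kv Kh Kuv k kl.
pose k' (z : syzygy M n.+1) : R^o := k (u (val z)).
have zK (z : syzygy M n.+1) : K (u (val z)) by apply/uK/eqP/(valP z).
have k'l : linear k'.
  by move=> c z z'; rewrite /k' linearP kl.
have [w wE] := Ext_class (to_linear k'l); exists w => y.
rewrite {}wE; split=> [[mu muE]|[l lE]]; last first.
  have ll : linear (fun z => l (u z) : R^o) by move=> c z z'; rewrite !linearP.
  by exists (to_linear ll) => z; exact/lE/zK.
pose t : {linear F -> F} := ((u \o v) \- idfun) \- h.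
(* On K the map u \o v is t plus the identity: the correction k \o t turns the
   extension of k \o u, pulled back along v, into an extension of k. *)
pose l (w : F) : R^o := mu (v w) - k (t w) * y.
have ll : linear l.
  move=> c a b; rewrite /l !(linearP t) kl; [|exact: Kuv..].
  by rewrite !linearP mulrDl -mulrA opprD addrACA scalerBr.
exists (to_linear ll) => a Ka /=.
have aK : v a \in kerp (@augment R (syzygy M n)) by apply/eqP/Kv.
pose a' : syzygy M n.+1 := exist _ (v a) aK.
rewrite /l (muE a') /= /k' /= Kh // subr0 -mulrBl; congr (_ * _).
rewrite [u (v a) - a]addrC -scaleN1r kl //; last exact: (zK a').
by rewrite mulN1r opprD opprK addrCA subrr addr0.
Qed.

Section Surjection.
Variables (R : pzRingType) (Z F : lmodType R) (p : {linear F -> Z}).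
Hypotheses (projF : projective F) (p_surj : forall z, exists w, p w = z).

(** Here F plays the role of the free cover of Z, and no homotopy is needed:
    u \o v is the identity modulo the kernel of p. *)
Lemma Ext1_class_kernel (k : F -> R) : linear_on (fun w => p w = 0) k ->
  exists w : Ext Z 1, forall y : R, (y : R^c) *: w = 0 <->
    extends (fun w => p w = 0) (fun w => k w * y).
Proof.
have [u uE] := free_projective (fun z => p_surj (@augment R Z z)).
have [v vE] := projF (fun w => augment_surj (p w)).
pose h : {linear F -> F} := \0.
apply: (@Ext_class_comparison R Z F 0 _ u v h).
- by move=> z z0; rewrite uE.
- by move=> w w0; rewrite vE.
- by [].
- by move=> w; rewrite subr0 linearB /= uE vE subrr.
Qed.

Lemma Ext1_eq0_extends (k : F -> R) : (forall w : Ext Z 1, w = 0) ->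
  linear_on (fun w => p w = 0) k -> extends (fun w => p w = 0) k.
Proof.
move=> E0 /Ext1_class_kernel[w wE].
have [l lE] : extends (fun w => p w = 0) (fun w => k w * 1).
  by apply/wE; rewrite (E0 w) scaler0.
by exists l => a a0; rewrite lE // mulr1.
Qed.

End Surjection.

(** Degree 2 is degree 1 for the first syzygy of X. The lifts u1, v1 are those
    of the usual comparison theorem for resolutions. *)
Lemma Ext2_class_kernel (R : pzRingType) (X F0 F1 : lmodType R)
    (p : {linear F0 -> X}) (d : {linear F1 -> F0}) :
  projective F0 -> projective F1 -> (forall x, exists z, p z = x) ->
  (forall z, p z = 0 <-> exists w, d w = z) ->
  forall k : F1 -> R, linear_on (fun w => d w = 0) k ->
  exists w : Ext X 2, forall y : R, (y : R^c) *: w = 0 <->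
    extends (fun w => d w = 0) (fun w => k w * y).
Proof.
move=> pr0 pr1 p_surj pd.
have [u0 u0E] := free_projective (fun x => p_surj (@augment R X x)).
have [v0 v0E] := pr0 _ _ _ _ (fun z => augment_surj (p z)).
have aug0 (z : ker (@augment R X)) : augment (val z) = 0 by apply/eqP/(valP z).
pose f1 := u0 \o val \o @augment R (ker (@augment R X)).
have f1_im z : exists w, d w = f1 z.
  by apply/pd; rewrite /f1 /= u0E; exact: aug0.
have [u1 u1E] := @free_projective _ _ _ _ d
  (f1 : {linear free_mod (ker (@augment R X)) -> F0}) f1_im.
have g1_im w : exists z, res_d X 0 z = (v0 \o d) w.
  have [|z zE] := proj1 (res_exact0 (v0 (d w))); last by exists z.
  by rewrite v0E; apply/pd; exists w.
have [v1 v1E] := pr1 _ _ _ _ g1_im.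
(* h is the homotopy between u0 \o v0 and the identity. *)
have t0_im z : exists w, d w = ((u0 \o v0) \- idfun) z.
  by apply/pd; rewrite /= linearB u0E v0E subrr.
have [h hE] := pr0 _ _ _ _ t0_im.
apply: (@Ext_class_comparison R X F1 1 _ u1 v1 (h \o d)).
- by move=> z z0; rewrite u1E /f1 /= z0 !linear0.
- move=> w w0; apply/val_inj.
  by rewrite -[LHS]/(res_d X 0 (v1 w)) v1E /= w0 linear0.
- by move=> w w0 /=; rewrite w0 linear0.
- move=> w; rewrite !linearB /= u1E hE /= /f1 /=.
  rewrite -[val _]/(res_d X 0 (v1 w)) v1E /=.
  exact: subrr.
Qed.

(** * The Auslander condition on cyclic submodules of Ext *)

Section Cyclic.
Variables (R : pzRingType) (E : lmodType R) (w : E).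

Definition cyclicp : {pred E} := fun z => `[< exists y : R, y *: w = z >].

Lemma cyclicp_submod : submod_closed cyclicp.
Proof.
split=> [|c u v /asboolP[y <-] /asboolP[y' <-]]; apply/asboolP.
  by exists 0; rewrite scale0r.
by exists (c * y + y'); rewrite scalerDl scalerA.
Qed.

HB.instance Definition _ := GRing.isSubmodClosed.Build R E cyclicp
  (GRing.submod_closed_semi cyclicp_submod).

Definition cyclic := {z : E | z \in cyclicp}.
HB.instance Definition _ := SubChoice.on cyclic.
HB.instance Definition _ := [SubChoice_isSubLmodule of cyclic by <:].

Fact cyclic_gen_subproof : w \in cyclicp.
Proof. by apply/asboolP; exists 1; rewrite scale1r. Qed.

Definition cyclic_gen : cyclic := exist _ w cyclic_gen_subproof.

Fact cyclic_map_linear : linear (fun y : R^o => (y : R) *: cyclic_gen).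
Proof. by move=> c y y'; rewrite scalerDl scalerA. Qed.

Definition cyclic_map : {linear R^o -> cyclic} := to_linear cyclic_map_linear.

Lemma cyclic_map_surj z : exists y, cyclic_map y = z.
Proof. by have /asboolP[y yE] := valP z; exists y; apply: val_inj. Qed.

Lemma cyclic_map_eq0 y : cyclic_map y = 0 <-> (y : R) *: w = 0.
Proof. by split=> [/(congr1 val)|yw]; [|apply: val_inj]. Qed.

End Cyclic.

Lemma factor_surj (R : pzRingType) (F Z V : lmodType R) (p : {linear F -> Z})
    (f : {linear F -> V}) :
  (forall z, exists w, p w = z) -> (forall w, p w = 0 -> f w = 0) ->
  exists g : {linear Z -> V}, forall w, g (p w) = f w.
Proof.
move=> p_surj fK; have [q pq] := choice p_surj.
have fE w w' : p w = p w' -> f w = f w'.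
  move=> e; apply/eqP; rewrite -subr_eq0 -linearB; apply/eqP/fK.
  by rewrite linearB e subrr.
have gl : linear (fun z => f (q z)).
  by move=> c z z'; rewrite -linearP; apply: fE; rewrite linearP !pq.
by exists (to_linear gl) => w; apply: fE; rewrite pq.
Qed.

Section Auslander.
Variables (R : pzRingType) (auslR : left_auslander R).
Variables (M : lmodType R) (fgM : fin_gen M).

Lemma grade_cyclic i (w : Ext M i) k : (k < i)%N ->
  forall x : Ext (cyclic w) k, x = 0.
Proof. exact/le_grade_Ext/(auslR fgM). Qed.

(** Multiplication by s factors through a linear map to R from the cyclic submodule
    generated by w, which has grade at least 1. *)
Lemma Ext1_annihilator (w : Ext M 1) (s : R) :
  (forall y : R, (y : R^c) *: w = 0 -> s * y = 0) -> s = 0.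
Proof.
move=> sL.
have fl : linear (fun y : R^c^o => (y : R^c) * s : R^c^o).
  by move=> c y y'; rewrite mulrDl -mulrA.
have [|g gE] := @factor_surj _ _ _ _ (cyclic_map w) (to_linear fl) (@cyclic_map_surj _ _ w).
  by move=> y /cyclic_map_eq0 /sL.
have := Ext0_eq0 g (@grade_cyclic 1 w 0 (ltn0Sn 0)).
move=> /(_ (cyclic_map w 1)); rewrite gE /=.
by rewrite mul1r.
Qed.

(** The cyclic submodule N generated by w is R / L with L the annihilator of w.
    Its grade is at least 2, so Ext^1(N, R) = 0 and every linear map L -> R
    extends to R. *)
Lemma Ext2_annihilator (w : Ext M 2) (phi : R -> R) :
  (forall y y' c : R, (y : R^c) *: w = 0 -> (y' : R^c) *: w = 0 ->
     phi (y * c + y') = phi y * c + phi y') ->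
  exists s, forall y : R, (y : R^c) *: w = 0 -> phi y = s * y.
Proof.
move=> phil.
have [||l lE] := @Ext1_eq0_extends _ _ _ (cyclic_map w)
  (@regular_projective _) (@cyclic_map_surj _ _ w) (phi : R^c^o -> R^c).
- exact: (@grade_cyclic 2 w 1 (ltnSn 1)).
- move=> c y y' /cyclic_map_eq0 yw /cyclic_map_eq0 yw'; exact: phil.
exists (l 1 : R) => y /cyclic_map_eq0 /lE <-.
by rewrite -[y in l y](@mulr1 R^c) linearZ.
Qed.

End Auslander.

(** * Noetherian modules and cokernels *)

Definition submodule (R : pzRingType) (M : lmodType R) (I : M -> Prop) : Prop :=
  I 0 /\ forall c x y, I x -> I y -> I (c *: x + y).

(** The ascending chain condition, turned by dependent choice into the existence
    of maximal elements. *)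
Lemma noetherian_maximal (R : pzRingType) (M : lmodType R)
    (P : (M -> Prop) -> Prop) :
  noetherian_module M -> (forall I, P I -> submodule I) -> (exists I, P I) ->
  exists I, P I /\ forall J, P J -> (forall x, I x -> J x) -> forall x, J x -> I x.
Proof.
move=> noeth Psub [I0 PI0]; apply: contrapT => nomax.
have step (I : {I | P I}) : exists J : {I | P I},
    (forall x, sval I x -> sval J x) /\ exists x, sval J x /\ ~ sval I x.
  case: I => I PI /=; apply: contrapT => noJ; apply: nomax.
  exists I; split=> // J PJ IJ x Jx; apply: contrapT => nIx; apply: noJ.
  by exists (exist _ J PJ); split=> //; exists x.
have [f fP] := choice step.
pose c n := sval (iter n f (exist _ I0 PI0)).
have c_sub n : submodule (c n) by apply/Psub/svalP.
have [||n nP] := noeth (fun n x => `[< c n x >]).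
- move=> n; have [c0 cS] := c_sub n; split=> [|k x y /asboolP xP /asboolP yP].
    exact/asboolP.
  exact/asboolP/cS.
- by move=> n x /asboolP xP; apply/asboolP; have [+ _] := fP (iter n f (exist _ I0 PI0)); apply.
have [_ [x [cx ncx]]] := fP (iter n f (exist _ I0 PI0)).
apply: ncx; apply/asboolP.
by have := nP n.+1 (leqnSn n) x; rewrite !unfold_in => <-; apply/asboolP.
Qed.

Definition fg_sub (R : pzRingType) (M : lmodType R) (I : M -> Prop) : Prop :=
  exists n (e : 'I_n -> M), (forall k, I (e k)) /\
    forall x, I x -> exists c : 'I_n -> R, x = \sum_(k < n) c k *: e k.

Lemma submodule_sum (R : pzRingType) (M : lmodType R) (I : M -> Prop) n
    (e : 'I_n -> M) (c : 'I_n -> R) :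
  submodule I -> (forall k, I (e k)) -> I (\sum_(k < n) c k *: e k).
Proof.
by move=> [I0 IS] Ie; elim/big_rec: _ => // k x _; apply: IS.
Qed.

Lemma noetherian_fg (R : pzRingType) (M : lmodType R) (I : M -> Prop) :
  noetherian_module M -> submodule I -> fg_sub I.
Proof.
move=> noeth subI.
pose span n (e : 'I_n -> M) x := exists c : 'I_n -> R, x = \sum_(k < n) c k *: e k.
pose P J := exists n (e : 'I_n -> M), (forall k, I (e k)) /\ J = span n e.
have [||J [[n [e [Ie ->]]] max]] := @noetherian_maximal _ _ P noeth.
- move=> _ [n [e [_ ->]]]; split=> [|c _ _ [k ->] [l ->]].
    by exists (fun=> 0); rewrite big1 // => k _; rewrite scale0r.
  exists (fun i => c * k i + l i); rewrite scaler_sumr -big_split.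
  by apply: eq_bigr => i _; rewrite scalerDl scalerA.
- by exists (span 0%N (fun=> 0)), 0%N, (fun=> 0); split=> // -[].
exists n, e; split=> // x Ix.
pose e' (i : 'I_n.+1) := if unlift ord0 i is Some j then e j else x.
apply: (max (span _ e')).
- exists n.+1, e'; split=> // k; rewrite /e'.
  by case: unlift.
- move=> _ [c ->]; exists (fun i => if unlift ord0 i is Some j then c j else 0).
  rewrite big_ord_recl /= unlift_none scale0r add0r.
  by apply: eq_bigr => i _; rewrite /e' liftK.
exists (fun i => if unlift ord0 i is Some j then 0 else 1).
rewrite big_ord_recl /e' /= unlift_none scale1r big1 ?addr0 // => i _.
by rewrite liftK scale0r.
Qed.

(** Generators of the image, lifted, together with generators of the part of K
    in the kernel, generate K. *)
Lemma fg_extension (R : pzRingType) (V W : lmodType R) (f : {linear V -> W})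
    (K : V -> Prop) : submodule K ->
  fg_sub (fun w => exists2 v, K v & f v = w) ->
  fg_sub (fun v => K v /\ f v = 0) -> fg_sub K.
Proof.
move=> subK [n [e [eK eP]]] [m [d [dK dP]]].
have lift k : exists v, K v /\ f v = e k by have [v] := eK k; exists v.
have [e' e'P] := choice lift.
exists (n + m)%N, (fun i => match fintype.split i with inl j => e' j | inr j => d j end).
split=> [i|x Kx]; first by case: fintype.split => j; [case: (e'P j)|case: (dK j)].
have [c cE] := eP (f x) (ex_intro2 _ _ x Kx erefl).
pose y := \sum_(k < n) c k *: e' k.
have Ky : K y by apply: submodule_sum => // k; case: (e'P k).
have [|b bE] := dP (x - y).
  split; first by rewrite addrC -scaleN1r; apply: (proj2 subK).
  rewrite linearB cE linear_sum; apply/eqP; rewrite subr_eq0; apply/eqP.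
  by apply: eq_bigr => k _; rewrite linearZ; case: (e'P k) => _ /= ->.
exists (fun i => match fintype.split i with inl j => c j | inr j => b j end).
rewrite big_split_ord /=.
under eq_bigr do rewrite -[lshift m _]/(unsplit (inl _)) unsplitK.
under [X in _ = _ + X]eq_bigr do rewrite -[rshift n _]/(unsplit (inr _)) unsplitK.
by rewrite -bE -/y addrC subrK.
Qed.

Lemma row_fg (R : pzRingType) n (K : 'rV[R]_n -> Prop) :
  noetherian_module R^o -> submodule K -> fg_sub K.
Proof.
move=> noeth subK.
have [s sP] : exists s : seq 'I_n, forall v, K v -> forall j, j \notin s -> v 0 j = 0.
  by exists (enum 'I_n) => v _ j; rewrite mem_enum.
elim: s K subK sP => [|i s IHs] K subK sP.
  exists 0%N, (fun=> 0); split=> [[]//|x Kx]; exists (fun=> 0).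
  by rewrite big_ord0; apply/rowP => j; rewrite mxE (sP x).
have pl : linear (fun v : 'rV[R]_n => v 0 i : R^o) by move=> c u v; rewrite !mxE.
have [K0 KS] := subK.
apply: (fg_extension (f := to_linear pl)) => //.
  apply: noetherian_fg => //; split=> [|c _ _ [v Kv <-] [w Kw <-]].
    by exists 0; rewrite ?linear0.
  by exists (c *: v + w); [exact: KS|rewrite linearP].
apply: IHs => [|v [Kv /= vi] j js].
  split=> [|c x y [Kx x0] [Ky y0]]; first by rewrite linear0.
  by split; [exact: KS|rewrite linearP x0 y0 scaler0 addr0].
have [->//|ji] := eqVneq j i.
by rewrite (sP v) // inE (negPf ji).
Qed.

Section Cokernel.
Variables (R : pzRingType) (U V : lmodType R) (d : {linear U -> V}).

Definition imagep : {pred V} := fun z => `[< exists w, d w = z >].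

Lemma imagep_submod : submod_closed imagep.
Proof.
split=> [|c u v /asboolP[y <-] /asboolP[y' <-]]; apply/asboolP.
  by exists 0; rewrite linear0.
by exists (c *: y + y'); rewrite linearP.
Qed.

HB.instance Definition _ := GRing.isSubmodClosed.Build R V imagep
  (GRing.submod_closed_semi imagep_submod).

Definition coker : lmodType R := quot_lmod imagep.
Definition coker_pi : {linear V -> coker} := quot_pi imagep.

Lemma coker_pi_eq0 z : coker_pi z = 0 <-> exists w, d w = z.
Proof. by rewrite quot_pi_eq0; split=> /asboolP. Qed.

Lemma coker_pi_surj x : exists z, coker_pi z = x.
Proof. exact: quot_pi_surj. Qed.

Lemma coker_fin_gen : fin_gen V -> fin_gen coker.
Proof.
move=> [n [e eP]]; exists n, (fun i => coker_pi (e i)) => x.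
have [z <-] := coker_pi_surj x; have [c ->] := eP z; exists c.
by rewrite linear_sum; apply: eq_bigr => k _; rewrite linearZ.
Qed.

End Cokernel.

Lemma regular_fin_gen (R : pzRingType) : fin_gen (R^o : lmodType R).
Proof.
exists 1%N, (fun=> 1) => r; exists (fun=> r).
by rewrite big_ord1; exact/esym/mulr1.
Qed.

Lemma row_fin_gen (R : pzRingType) n : fin_gen ('rV[R]_n : lmodType R).
Proof.
exists n, (delta_mx 0) => v; exists (v 0); exact: row_sum_delta.
Qed.

(** * Consequences of the Auslander condition for right ideals *)

Definition rideal (R : pzRingType) (A : R -> Prop) : Prop :=
  A 0 /\ forall c x y, A x -> A y -> A (x * c + y).

Definition rlinear_on (R : pzRingType) (A : R -> Prop) (f : R -> R) : Prop :=
  forall c x y, A x -> A y -> f (x * c + y) = f x * c + f y.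

(** The elements x to which every linear map A -> R can be extended, that is, the
    set of x such that f extends to A + xR for all f: the element s is the value of
    the extension at x. When R embeds in a quotient ring and A contains a unit
    of it, this is the divisorial (double dual) closure of A. *)
Definition hull (R : pzRingType) (A : R -> Prop) (x : R) : Prop :=
  forall f, rlinear_on A f -> exists s, forall y, A (x * y) -> f (x * y) = s * y.

Section TorsionLemmas.
Variables (R : pzRingType) (auslR : left_auslander R).
Variables (a : R) (regr_a : GRing.rreg a).

(** R/aR is Ext^1(R/Ra, R), so that the Auslander condition gives
    Hom(xR + aR / aR, R) = 0. Explicitly, the class of the map Ra -> R that sends
    ra to rx has for annihilator the set of y with xy in aR. *)
Lemma annihilator_mod (x s : R) :
  (forall y t, x * y = a * t -> s * y = 0) -> s = 0.
Proof.
move=> sL.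
have dl : linear (fun r : R^o => (r : R) * a : R^o).
  by move=> c r r' /=; rewrite mulrDl -mulrA.
pose d := to_linear dl.
(* q is the division by a on the right. *)
have [q qE] : exists q : R -> R, forall r, q (r * a) = r.
  have h z : exists r, forall r', z = r' * a -> r' = r.
    have [[r ->]|nr] := pselect (exists r, z = r * a).
      by exists r => r' /regr_a.
    by exists 0 => r' e; case: nr; exists r'.
  by have [q qE] := choice h; exists q => r; rewrite -(qE _ r).
have [|w wE] := @Ext1_class_kernel R (coker d) R^o (coker_pi d)
    (@regular_projective R) (@coker_pi_surj _ _ _ d) (fun z => q z * x).
  move=> c _ _ /coker_pi_eq0[r <-] /coker_pi_eq0[r' <-].
  by rewrite -linearP /= !qE mulrDl mulrA.
apply: (Ext1_annihilator auslR (coker_fin_gen d (@regular_fin_gen R)) (w := w)).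
move=> y /wE[l lE].
have : l (d 1) = q (d 1) * x * y by apply: lE; apply/coker_pi_eq0; exists 1.
rewrite /= qE mul1r mul1r -[a in l a](@mulr1 R) => e; apply: (sL y (l 1)).
by rewrite -e linearZ.
Qed.

(** The Auslander condition makes (A + xR)/A a module of grade at least 2, hence
    the maps on the ideal of all y with xy in A extend to R. Indeed A is finitely
    presented, so dualizing a presentation gives an exact sequence
    0 -> A* -> R^n -> R^m -> X -> 0 of left modules, and the quotient of
    the hull of A by A is embedded in Ext^2(X, R): the class attached to x is
    that of the evaluation at x on A*. *)
Lemma hull_torsion (A : R -> Prop) (x : R) (phi : R -> R) :
  noetherian_module R^c^o -> rideal A -> A a -> hull A x ->
  rlinear_on (fun y => A (x * y)) phi ->
  exists s, forall y, A (x * y) -> phi y = s * y.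
Proof.
move=> noeth idA Aa clx phil.
have [n [e [eA eP]]] : exists n (e : 'I_n -> R), (forall k, A (e k)) /\
    forall z, A z -> exists t : 'I_n -> R, z = \sum_k e k * t k.
  have [|n [e [eA eP]]] := @noetherian_fg _ R^c^o A noeth.
    by case: idA => A0 AS; split.
  by exists n, e; split.
have Ae (t : 'I_n -> R) : A (\sum_k e k * t k).
  by case: idA => A0 AS; elim/big_rec: _ => // k z _; exact: AS.
(* The columns of rho generate the relations between the generators e. *)
have [m [rho [rhoK rhoP]]] :
    fg_sub (fun r : 'rV[R^c]_n => \sum_k (e k : R) * r 0 k = 0 :> R).
  apply: row_fg => //; split=> [|c r r' r0 r'0].
    by rewrite big1 // => k _; rewrite mxE mulr0.
  transitivity ((\sum_k (e k : R) * r 0 k) * c + \sum_k (e k : R) * r' 0 k).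
    rewrite mulr_suml -big_split; apply: eq_bigr => k _.
    by rewrite !mxE mulrDr -mulrA.
  by rewrite r0 r'0 mul0r addr0.
(* Row vectors killed by d are the linear maps A -> R, given by their values
   at the generators. *)
pose df (v : 'rV[R]_n) : 'rV[R]_m := \row_j \sum_k v 0 k * (rho j 0 k : R).
have dl : linear df.
  move=> c u v; apply/rowP => j; rewrite !mxE mulr_sumr -big_split.
  by apply: eq_bigr => k _; rewrite !mxE mulrDl mulrA.
pose d := to_linear dl.
have dK v (r : 'I_n -> R) : d v = 0 -> \sum_k e k * r k = 0 -> \sum_k v 0 k * r k = 0.
  move=> v0 r0; have [|c cE] := rhoP (\row_k r k).
    by rewrite -[RHS]r0; apply: eq_bigr => k _; rewrite mxE.
  have rE k : r k = \sum_j (rho j 0 k : R) * c j.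
    have := congr1 (fun u : 'rV_n => u 0 k) cE; rewrite mxE => ->.
    by rewrite summxE; apply: eq_bigr => j _; rewrite mxE.
  under eq_bigr do rewrite rE mulr_sumr.
  rewrite exchange_big big1 // => j _.
  under eq_bigr do rewrite mulrA.
  rewrite -mulr_suml.
  have := congr1 (fun u : 'rV_m => u 0 j) v0; rewrite !mxE => ->.
  by rewrite mul0r.
have dKeq v (r r' : 'I_n -> R) : d v = 0 -> \sum_k e k * r k = \sum_k e k * r' k ->
    \sum_k v 0 k * r k = \sum_k v 0 k * r' k.
  move=> v0 rr'; apply/eqP; rewrite -subr_eq0 -sumrB.
  under eq_bigr do rewrite -mulrBr.
  apply/eqP/dK => //; under eq_bigr do rewrite mulrBr.
  by rewrite sumrB rr' subrr.
(* s is the value at x of the extension to A + xR of the map given by v. *)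
pose mult (v : 'rV[R]_n) s := forall y (t : 'I_n -> R),
  x * y = \sum_k e k * t k -> \sum_k v 0 k * t k = s * y.
have mult_uniq v s s' : mult v s -> mult v s' -> s = s'.
  move=> sE s'E; apply/eqP; rewrite -subr_eq0; apply/eqP.
  apply: (annihilator_mod (x := x)) => y t xy.
  have [t' t'E] : exists t' : 'I_n -> R, x * y = \sum_k e k * t' k.
    by apply: eP; rewrite xy -[a * t]addr0; case: idA => A0 AS; exact: AS.
  by rewrite mulrBl -(sE y t') // -(s'E y t') // subrr.
have mult_ex v : exists s, d v = 0 -> mult v s.
  have [v0|v0] := pselect (d v = 0); last by exists 0.
  have h z : exists t : 'I_n -> R, A z -> z = \sum_k e k * t k.
    by have [/eP[t ->]|nA] := pselect (A z); [exists t|exists (fun=> 0)].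
  have [t tE] := choice h.
  have [|s sE] := clx (fun z => \sum_k v 0 k * t z k).
    move=> c z z' Az Az'; rewrite mulr_suml -big_split /=.
    under [RHS]eq_bigr do rewrite -mulrA -mulrDr.
    apply: dKeq => //; rewrite -tE; last by case: idA => A0 AS; exact: AS.
    under [RHS]eq_bigr do rewrite mulrDr mulrA.
    by rewrite big_split -mulr_suml -!tE.
  exists s => _ y r yr; rewrite -sE ?yr //; apply: dKeq => //.
  by rewrite -tE.
have [k kE] := choice mult_ex.
have [|w wE] := @Ext2_class_kernel R (coker d) 'rV[R]_m 'rV[R]_n (coker_pi d) d
    (@row_projective R m) (@row_projective R n) (@coker_pi_surj _ _ _ d)
    (@coker_pi_eq0 _ _ _ d) k.
  move=> c u v u0 v0; apply: (mult_uniq (c *: u + v)).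
    by apply: kE; rewrite linearP u0 v0 scaler0 addr0.
  move=> y t xy; rewrite mulrDl -mulrA -(kE u u0 _ _ xy) -(kE v v0 _ _ xy).
  rewrite mulr_sumr -big_split; apply: eq_bigr => i _.
  by rewrite !mxE mulrDl mulrA.
have wA y : (y : R^c) *: w = 0 <-> A (x * y).
  rewrite wE; split=> [[l lE]|/eP[t xy]].
    (* The row of generators is the inclusion of A in R, of value x at x. *)
    pose v : 'rV[R]_n := \row_i e i.
    have v0 : d v = 0.
      apply/rowP => j; rewrite !mxE -[RHS](rhoK j); apply: eq_bigr => i _.
      by rewrite mxE.
    have -> : x = k v.
      apply: (mult_uniq v); last exact: kE.
      by move=> z t ->; apply: eq_bigr => i _; rewrite mxE.
    rewrite -lE // (row_sum_delta v) linear_sum.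
    have -> : \sum_i l (v 0 i *: 'e_i) = \sum_i e i * (l ('e_i) : R).
      by apply: eq_bigr => i _; rewrite linearZ mxE.
    exact: Ae.
  have ll : linear (fun v : 'rV[R]_n => \sum_i v 0 i * t i : R^o).
    move=> c u v; rewrite scaler_sumr -big_split; apply: eq_bigr => i _.
    by rewrite !mxE mulrDl -mulrA.
  by exists (to_linear ll) => v v0 /=; apply: kE.
have [|s sE] := Ext2_annihilator auslR (coker_fin_gen d (@row_fin_gen R m))
    (w := w) (phi := phi).
  by move=> y y' c /wA Ay /wA Ay'; exact: phil.
by exists s => y /wA /sE.
Qed.

End TorsionLemmas.

(** * Closed right ideals and their rank *)

Section RightIdeal.
Variables (R : pzRingType) (A : R -> Prop) (idA : rideal A).

Lemma ridealM x c : A x -> A (x * c).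
Proof. by move=> Ax; rewrite -[_ * c]addr0; case: idA => A0 AS; exact: AS. Qed.

Lemma ridealD x y : A x -> A y -> A (x + y).
Proof. by move=> Ax Ay; rewrite -[x]mulr1; case: idA => A0 AS; exact: AS. Qed.

Variables (f : R -> R) (fl : rlinear_on A f).

Lemma rlinear_on0 : f 0 = 0.
Proof.
have [A0 _] := idA; have := fl 1 A0 A0; rewrite mul0r addr0 mulr1 => e.
by apply: (addrI (f 0)); rewrite -e addr0.
Qed.

Lemma rlinear_onM x c : A x -> f (x * c) = f x * c.
Proof. by move=> Ax; have [A0 _] := idA; have := fl c Ax A0; rewrite rlinear_on0 !addr0. Qed.

Lemma rlinear_onD x y : A x -> A y -> f (x + y) = f x + f y.
Proof. by move=> Ax Ay; have := fl 1 Ax Ay; rewrite !mulr1. Qed.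

End RightIdeal.

Section ClosedIdeals.
Variables (R : pzRingType) (auslR : left_auslander R).
Variables (noethl : noetherian_module R^o) (noethr : noetherian_module R^c^o).
Variables (a : R) (can_a : cancellative a).

(** Maps on an ideal that contains a are determined by their value at a: most
    identities below are checked after multiplication by the elements that bring
    x into aR. *)
Lemma eq_mod (x u v : R) :
  (forall y t, x * y = a * t -> u * y = v * y) -> u = v.
Proof.
move=> uv; apply/eqP; rewrite -subr_eq0; apply/eqP.
apply: (annihilator_mod auslR (proj2 can_a) (x := x)) => y t xy.
by rewrite mulrBl (uv y t xy) subrr.
Qed.

Definition rideal_over (A : R -> Prop) : Prop := rideal A /\ A a.

Lemma over_mul A t : rideal_over A -> A (a * t).
Proof. by move=> [idA Aa]; apply: ridealM. Qed.

Definition closed_ideal (A : R -> Prop) : Prop :=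
  rideal_over A /\ forall x : R, hull A x -> A x.

Lemma sub_hull (A : R -> Prop) x : rideal A -> A x -> hull A x.
Proof. by move=> idA Ax f fl; exists (f x) => y _; exact: (rlinear_onM idA fl). Qed.

Lemma multiplier_uniq A f (x : R) s s' : rideal_over A ->
  (forall y, A (x * y) -> f (x * y) = s * y) ->
  (forall y, A (x * y) -> f (x * y) = s' * y) -> s = s'.
Proof.
move=> oA sE s'E; apply: (eq_mod (x := x)) => y t xy.
by rewrite -sE ?xy -?s'E ?xy //; apply: over_mul.
Qed.

Lemma multiplier_linear A f (x : R) x' s s' c : rideal_over A -> rlinear_on A f ->
  (forall y, A (x * y) -> f (x * y) = s * y) ->
  (forall y, A (x' * y) -> f (x' * y) = s' * y) ->
  forall y, A ((x * c + x') * y) -> f ((x * c + x') * y) = (s * c + s') * y.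
Proof.
move=> oA fl sE s'E y Ay; have [idA Aa] := oA.
apply: (eq_mod (x := x * c * y)) => z t e.
have A1 : A (x * (c * y * z)) by rewrite !mulrA e; apply: over_mul.
have A2 : A (x' * (y * z)).
  have -> : x' * (y * z) = (x * (c * y * z)) * (- 1) + ((x * c + x') * y) * z.
    by rewrite mulrN1 !mulrDl !mulrA addKr.
  by have [_ AS] := idA; apply: AS => //; apply: ridealM.
rewrite -(rlinear_onM idA fl _ Ay).
have -> : (x * c + x') * y * z = x * (c * y * z) + x' * (y * z).
  by rewrite !mulrDl !mulrA.
by rewrite (rlinear_onD fl) // sE // s'E // !mulrDl !mulrA.
Qed.

Lemma hull_over A : rideal_over A -> rideal_over (hull A).
Proof.
move=> oA; have [idA Aa] := oA; split; last exact: sub_hull.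
split=> [|c x x' clx clx' f fl].
  by apply: sub_hull => //; case: idA.
have [s sE] := clx f fl; have [s' s'E] := clx' f fl.
by exists (s * c + s'); apply: multiplier_linear.
Qed.

Lemma hull_mono A B (x : R) : rideal_over A -> rideal_over B -> (forall z, A z -> B z) ->
  hull A x -> hull B x.
Proof.
move=> oA oB AB clx f fl.
have [|s sE] := clx f; first by move=> c y z Ay Az; apply: fl; apply: AB.
exists s => y By; apply: (eq_mod (x := x * y)) => z t e.
have Axyz : A (x * (y * z)) by rewrite mulrA e; apply: over_mul.
rewrite -(rlinear_onM (proj1 oB) fl z By) -mulrA sE //.
by rewrite mulrA.
Qed.

Lemma hull_closed A : rideal_over A -> closed_ideal (hull A).
Proof.
move=> oA; split=> [|x clx f fl]; first exact: hull_over.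
have h z : exists s, hull A z -> forall y, A (z * y) -> f (z * y) = s * y.
  have [/(_ f fl)[s sE]|nz] := pselect (hull A z); first by exists s.
  by exists 0.
have [g gE] := choice h.
have [idcl _] := hull_over oA.
have [|s sE] := clx g.
  move=> c y z cly clz; apply: (multiplier_uniq (x := y * c + z) (f := f) oA).
    by apply: gE; case: idcl => _; apply.
  by apply: multiplier_linear => //; apply: gE.
exists s => y Ay; have cly := sub_hull (proj1 oA) Ay.
rewrite -sE // -[x * y]mulr1 gE ?mulr1 //.
Qed.

(** The extension to x of the inverse of multiplication by b gives the quotient of
    x by b. *)
Lemma closed_principal b c : a = b * c -> GRing.lreg b ->
  closed_ideal (fun x => exists r, x = b * r).
Proof.
move=> abc lb; have ob : rideal_over (fun x => exists r, x = b * r).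
  split; last by exists c.
  split=> [|k _ _ [r ->] [r' ->]]; first by exists 0; rewrite mulr0.
  by exists (r * k + r'); rewrite mulrDr mulrA.
split=> // x clx.
have h z : exists r, (exists r, z = b * r) -> z = b * r.
  by have [[r ->]|nr] := pselect (exists r, z = b * r); [exists r|exists 0].
have [q qE] := choice h.
have qb r : q (b * r) = r by apply: lb; rewrite -qE //; exists r.
have [|s sE] := clx q.
  by move=> k _ _ [r ->] [r' ->]; rewrite -mulrA -mulrDr !qb.
exists s; apply: (eq_mod (x := x)) => y t e.
have xy : x * y = b * (c * t) by rewrite e abc mulrA.
by rewrite -mulrA -sE xy ?qb //; exists (c * t).
Qed.

(** The crucial compatibility: (xR + A)/A and (xR + A `&` C)/(A `&` C) are the same
    module for x in C, and its Ext^1 vanishes. *)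
Lemma hull_meet A C (x : R) : rideal_over A -> rideal_over C -> hull A x -> C x ->
  hull (fun z => A z /\ C z) x.
Proof.
move=> oA oC clx Cx f fl; have [[idA Aa] [idC Ca]] := (oA, oC).
have [|s sE] := @hull_torsion R auslR a (proj2 can_a) A x (fun y => f (x * y))
    noethr idA Aa clx.
  move=> c y z Ay Az; rewrite mulrDr mulrA; apply: fl; split=> //; exact: ridealM.
by exists s => y [Ay _]; exact: sE.
Qed.

Lemma over_meet A C : rideal_over A -> rideal_over C ->
  rideal_over (fun z => A z /\ C z).
Proof.
move=> [[A0 AS] Aa] [[C0 CS] Ca]; split=> //; split=> // c y z [Ay Cy] [Az Cz].
by split; [exact: AS|exact: CS].
Qed.

Lemma closed_meet A C : closed_ideal A -> closed_ideal C ->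
  closed_ideal (fun z => A z /\ C z).
Proof.
move=> [oA clA] [oC clC]; have oM := over_meet oA oC; split=> // x clx.
by split; [apply: clA|apply: clC]; apply: hull_mono clx => // z [].
Qed.

Definition ideal_sum (A B : R -> Prop) : R -> Prop :=
  fun z => exists u v, [/\ A u, B v & z = u + v].

Lemma over_sum A B : rideal_over A -> rideal_over B -> rideal_over (ideal_sum A B).
Proof.
move=> [[A0 AS] Aa] [[B0 BS] Ba]; split; last by exists a, 0; rewrite addr0.
split=> [|c _ _ [u [v [Au Bv ->]]] [u' [v' [Au' Bv' ->]]]].
  by exists 0, 0; rewrite addr0.
exists (u * c + u'), (v * c + v'); split; [exact: AS|exact: BS|].
by rewrite mulrDl addrACA.
Qed.

(** The usual computation in a modular lattice; it applies to closed ideals because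
    the hull is compatible with intersections. *)
Lemma modularity C C' J : closed_ideal C -> closed_ideal C' -> closed_ideal J ->
  (forall x, C' x -> C x) -> (forall x, C x -> J x -> C' x) ->
  (forall x, hull (ideal_sum C J) x -> hull (ideal_sum C' J) x) ->
  forall x, C x -> C' x.
Proof.
move=> [oC clC] [oC' clC'] [oJ clJ] C'C CJ sub x Cx.
have J0 : J 0 by case: oJ => -[].
have clx : hull (ideal_sum C' J) x.
  apply/sub/sub_hull; first by case: (over_sum oC oJ).
  by exists x, 0; rewrite addr0.
apply: clC'; have oCJ := over_sum oC' oJ.
apply: hull_mono (hull_meet oCJ oC clx Cx) => //.
  exact: over_meet.
move=> _ [[u [v [C'u Jv ->]]] Cuv].
apply: (ridealD (proj1 oC')) => //; apply: CJ => //.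
have [[C0 CS] _] := oC.
have -> : v = u * (- 1) + (u + v) by rewrite mulrN1 addKr.
by apply: CS => //; apply: C'C.
Qed.

(** This is the dual of A, embedded in R by evaluation at a. *)
Definition values (A : R -> Prop) : R -> Prop :=
  fun r => exists2 f, rlinear_on A f & f a = r.

Lemma values_submodule A : submodule (values A : R^o -> Prop).
Proof.
split=> [|c _ _ [f fl <-] [g gl <-]].
  by exists (fun=> 0) => // c x y _ _; rewrite mul0r addr0.
exists (fun x => c * f x + g x) => // k x y Ax Ay.
by rewrite fl // gl // mulrDr mulrDl !mulrA addrACA.
Qed.

(** If the duals agree, every map on C' extends to C, so C lies in the hull
    of C'. *)
Lemma values_inj C C' : closed_ideal C -> closed_ideal C' -> (forall x, C' x -> C x) ->
  (forall r, values C' r -> values C r) -> forall x, C x -> C' x.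
Proof.
move=> [oC clC] [oC' clC'] C'C sub x Cx; apply: clC' => f fl.
have [g gl ga] : values C (f a) by apply: sub; exists f.
have [[idC Ca] [idC' C'a]] := (oC, oC').
exists (g x) => y C'xy; rewrite -(rlinear_onM idC gl) //.
apply: (eq_mod (x := x * y)) => z t e.
rewrite -(rlinear_onM idC' fl) // -(rlinear_onM idC gl) ?e //; last exact: C'C.
by rewrite (rlinear_onM idC' fl) // (rlinear_onM idC gl) // ga.
Qed.

Lemma closed_maximal (P : (R -> Prop) -> Prop) :
  (forall A, P A -> closed_ideal A) -> (exists A, P A) ->
  exists A, P A /\ forall B, P B -> (forall x, A x -> B x) -> forall x, B x -> A x.
Proof.
move=> Pcl; apply: (@noetherian_maximal _ R^c^o) => // A /Pcl[[[A0 AS] _] _].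
by split.
Qed.

(** Duality turns descending chains of closed right ideals into ascending chains
    of left ideals. *)
Lemma closed_minimal (P : (R -> Prop) -> Prop) :
  (forall A, P A -> closed_ideal A) -> (exists A, P A) ->
  exists A, P A /\ forall B, P B -> (forall x, B x -> A x) -> forall x, A x -> B x.
Proof.
move=> Pcl [A0 PA0].
have [||_ [[A [PA ->]] max]] :=
    @noetherian_maximal _ R^o (fun D => exists A, P A /\ D = values A) noethl.
- by move=> _ [A [_ ->]]; exact: values_submodule.
- by exists (values A0), A0.
exists A; split=> // B PB BA; apply: values_inj => //; try exact: Pcl.
apply: max; first by exists B.
by move=> r [f fl <-]; exists f => // c x y Bx By; apply: fl; apply: BA.
Qed.

(** Bounded length of the chains of closed ideals above I, witnessed by a strictly
    monotone function; this form avoids manipulating chains. *)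
Definition ranked (I : R -> Prop) : Prop := exists rho : (R -> Prop) -> nat,
  forall C C', closed_ideal C -> closed_ideal C' -> (forall x, I x -> C' x) ->
    (forall x, C' x -> C x) -> (exists2 x, C x & ~ C' x) -> (rho C' < rho C)%N.

(** Adding one simple layer at the bottom. Modularity says that C is determined
    among comparable ideals by its meet and its join with J. *)
Lemma ranked_step I J : closed_ideal I -> closed_ideal J -> (forall x, I x -> J x) ->
  (forall K, closed_ideal K -> (forall x, I x -> K x) -> (forall x, K x -> J x) ->
     (forall x, K x -> I x) \/ (forall x, J x -> K x)) ->
  ranked J -> ranked I.
Proof.
move=> clI clJ IJ simple [rho rhoP].
(* The first summand is the length of the part of C inside J, since C `&` J is
   I or J; the second is the rank of the part of C above J. *)
exists (fun C => `[< forall x, J x -> C x >] + rho (hull (ideal_sum C J)))%N.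
move=> C C' clC clC' IC' C'C [x Cx nC'x].
have [[oC _] [oC' _] [oJ _]] := And3 clC clC' clJ.
have oS := over_sum oC oJ; have oS' := over_sum oC' oJ.
have SS' z : ideal_sum C' J z -> ideal_sum C J z.
  by move=> [u [v [C'u Jv ->]]]; exists u, v; split=> //; apply: C'C.
have JS' z : J z -> hull (ideal_sum C' J) z.
  move=> Jz; apply: sub_hull; first by case: oS'.
  by exists 0, z; split=> //; [case: oC' => -[]|rewrite add0r].
have clS z : hull (ideal_sum C' J) z -> hull (ideal_sum C J) z.
  exact: hull_mono.
have leJ : (`[< forall x, J x -> C' x >] <= `[< forall x, J x -> C x >])%N.
  case: asboolP => // h; case: asboolP => // -[] z /h; exact: C'C.
have [[z Sz nS'z]|eqS] := pselect (exists2 z, hull (ideal_sum C J) z & ~ hull (ideal_sum C' J) z).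
  rewrite -addnS leq_add //; apply: rhoP => //; try exact: hull_closed.
  by exists z.
have {}eqS z : hull (ideal_sum C J) z -> hull (ideal_sum C' J) z.
  by move=> Sz; apply: contrapT => nz; apply: eqS; exists z.
have le_rho : (rho (hull (ideal_sum C' J)) <= rho (hull (ideal_sum C J)))%N.
  rewrite (_ : hull (ideal_sum C' J) = hull (ideal_sum C J)) //.
  by apply/funext => z; apply/propext; split; [exact: clS|exact: eqS].
rewrite -addSn leq_add //.
have nJC' : ~ forall z, J z -> C' z.
  move=> JC'; apply: nC'x; apply: (modularity clC clC' clJ) Cx => //.
  by move=> z _; exact: JC'.
rewrite (asboolF nJC'); case: asboolP => // nJC; exfalso.
have [||MI|JM] := simple _ (closed_meet clC clJ).
- by move=> z Iz; split; [exact/C'C/IC'|exact: IJ].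
- by move=> z [].
- apply: nC'x; apply: (modularity clC clC' clJ) Cx => //.
  by move=> z Cz Jz; apply/IC'/MI.
- by apply: nJC => z /JM[].
Qed.

(** A modular lattice with both chain conditions has finite length. *)
Lemma closed_ranked I : closed_ideal I -> ranked I.
Proof.
move=> clI; apply: contrapT => nrI.
have [||K [[clK nrK] max]] :=
  @closed_maximal (fun A => closed_ideal A /\ ~ ranked A).
- by move=> A [].
- by exists I.
have [x nKx] : exists x, ~ K x.
  apply: contrapT => allK; apply: nrK; exists (fun=> 0%N) => C C' _ _ KC' _ [x _ []].
  by apply: KC'; apply: contrapT => nKx; apply: allK; exists x.
have [||J [[clJ KJ [y Jy nKy]] min]] := @closed_minimal
  (fun A => [/\ closed_ideal A, forall z, K z -> A z & exists2 y, A y & ~ K y]).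
- by move=> A [].
- by exists (fun=> True); split=> //; exists x.
(* K is a largest bad ideal and J covers it, so J is good. *)
apply: nrK; apply: (ranked_step clK clJ KJ).
  move=> L clL KL LJ.
  have [[z Lz nKz]|nL] := pselect (exists2 z, L z & ~ K z).
    by right; apply: min => //; split=> //; exists z.
  by left=> z Lz; apply: contrapT => nKz; apply: nL; exists z.
apply: contrapT => nrJ; apply: nKy.
exact: (max J).
Qed.

End ClosedIdeals.

(** * Bounded factorizations *)

Lemma lreg_mul (R : pzRingType) (b c : R) :
  GRing.lreg b -> GRing.lreg c -> GRing.lreg (b * c).
Proof. by move=> lb lc x y; rewrite -!mulrA => /lb /lc. Qed.

Lemma right_inverse_unit (R : pzRingType) (u r : R) :
  GRing.lreg u -> u * r = 1 -> is_unit u.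
Proof. by move=> lu ur; exists r; split=> //; apply: lu; rewrite mulrA ur mul1r mulr1. Qed.

Lemma factorization_bound (R : pzRingType) (a : R) :
  left_auslander R -> noetherian_ring R -> cancellative a ->
  exists l, forall s : seq R,
    (forall u, u \in s -> cancellative u /\ ~ is_unit u) ->
    a = \prod_(u <- s) u -> (size s <= l)%N.
Proof.
move=> auslR [noethl noethr] can_a.
pose pr (b x : R) := exists r, x = b * r.
have pr_closed b c : a = b * c -> GRing.lreg b -> closed_ideal a (pr b).
  exact: (closed_principal auslR can_a).
have [rho rhoP] : ranked a (pr a).
  apply: (closed_ranked auslR noethl noethr can_a).
  by apply: (pr_closed a 1); [rewrite mulr1|case: can_a].
(* A nonunit factor u makes b * u * R strictly smaller than b * R, and both are
   closed. *)
have rho_prod s b : GRing.lreg b ->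
    (forall u, u \in s -> cancellative u /\ ~ is_unit u) ->
    a = b * \prod_(u <- s) u -> (size s <= rho (pr b))%N.
  elim: s b => [//|u s IHs] b lb sP; rewrite big_cons => abus.
  have [[lu _] nu] := sP u (mem_head u s).
  have lbu := lreg_mul lb lu.
  have abu : a = b * u * \prod_(v <- s) v by rewrite abus mulrA.
  apply: leq_ltn_trans (IHs _ lbu _ abu) _.
    by move=> v vs; apply: sP; rewrite inE vs orbT.
  apply: rhoP; [exact: pr_closed abus lb|exact: pr_closed abu lbu|..].
  - by move=> _ [r ->]; exists (\prod_(v <- s) v * r); rewrite abu !mulrA.
  - by move=> _ [r ->]; exists (u * r); rewrite mulrA.
  exists b; first by exists 1; rewrite mulr1.
  move=> [r br]; apply: nu; apply: (right_inverse_unit (r := r)) => //.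
  by apply: lb; rewrite mulrA -br mulr1.
exists (rho (pr 1)) => s sP as_; apply: rho_prod => //; last by rewrite mul1r.
by move=> x y; rewrite !mul1r.
Qed.

(** A factorization of maximal length into nonunits is one into atoms. *)
Lemma BF_of_bound (R : pzRingType) :
  (forall a : R, cancellative a -> exists l, forall s : seq R,
    (forall u, u \in s -> cancellative u /\ ~ is_unit u) ->
    a = \prod_(u <- s) u -> (size s <= l)%N) -> BF_ring R.
Proof.
move=> bound; split=> a can_a; last first.
  have [l lP] := bound a can_a; exists l => s sP; apply: lP => u /sP.
  by case.
move=> nu; have [l lP] := bound a can_a.
pose ok n := `[< exists s : seq R, [/\ size s = n,
  forall u, u \in s -> cancellative u /\ ~ is_unit u & a = \prod_(u <- s) u] >].
have ex_ok : exists n, ok n.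
  exists 1%N; apply/asboolP; exists [:: a]; split=> //; last by rewrite big_seq1.
  by move=> u; rewrite inE => /eqP ->.
have ok_le n : ok n -> (n <= l)%N by move=> /asboolP[s [<- sP as_]]; exact: lP.
case: (ex_maxnP ex_ok ok_le) => n /asboolP[s [sn sP as_]] max.
exists s => // u us; have [can_u nu_u] := sP u us.
split=> // x y can_x can_y uxy; apply: contrapT => nxy.
have [nx ny] : ~ is_unit x /\ ~ is_unit y.
  by split=> h; apply: nxy; [left|right].
(* Splitting u would give a factorization longer than the longest one. *)
case/splitPr: us sn sP as_ => s1 s2 sn sP as_.
suff /max : ok n.+1 by rewrite ltnn.
apply/asboolP; exists (s1 ++ x :: y :: s2); split.
- by rewrite -sn !size_cat /= !addnS.
- move=> v; rewrite mem_cat !inE => /or4P[vs|/eqP->|/eqP->|vs] //;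
    by apply: sP; rewrite mem_cat inE vs ?orbT.
- by rewrite as_ !big_cat /= !big_cons uxy !mulrA.
Qed.

Theorem corollary6p4 (R : pzRingType) : auslander_gorenstein R -> BF_ring R.
Proof.
move=> [noeth _ [auslR _]]; apply: BF_of_bound => a.
exact: factorization_bound.
Qed.
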